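(* Let $n,\lambda\ge2$ be even integers, $m=1+\frac{\lambda}{2}$, $\sigma>0$, $b_0>0$ and $0<\delta<\frac{b_0}{2(m+1)}$. Let $\rho$, $c_0$, $c_1$, $k$ and the function $MN:[c_0,\infty)\to(0,\infty)$ be as defined in the context. If $\lambda-n-1\ge0$ and $k\ge0$, then the optimal choice of $c\in[c_0,\infty)$ is $c=c_0$, i.e. $MN$ attains its minimum over $[c_0,\infty)$ at $c_0=24\rho(m+1)\delta$.
   Context: The constant $\rho$ is: $\rho=1+\frac{s}{2m+3}$ with $s=\lceil\frac{n-\lambda-3}{2}\rceil$ if $n-\lambda>3$; $\rho=1$ if $n-\lambda\le3$. $c_0:=24\rho(m+1)\delta$, $c_1:=12\rho b_0$, $k:=\frac{\sigma}{2}+\frac{\ln\frac23}{24\rho\delta}$. The MN function (for band-limited functions in $B_\sigma$, with $b_0$ fixed) is $$MN(c)=\begin{cases}\sqrt{8\rho}\,c^{\frac{\lambda-n-1}{4}}e^{c\left[\frac{\sigma}{2}+\frac{\ln\frac23}{24\rho\delta}\right]} & c_0\le c\le c_1,\\[1ex] \sqrt{\frac{2}{3b_0}}\,c^{\frac{1+\lambda-n}{4}}e^{\frac{c\sigma}{2}}\left(\frac23\right)^{\frac{b_0}{2\delta}} & c_1\le c<\infty.\end{cases}$$ The two formulas agree at $c=c_1$. A value of $c\in[c_0,\infty)$ is called optimal if it minimizes $MN$ over $[c_0,\infty)$. *)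

(* Defs.v *)
From HB Require Import structures.
From mathcomp Require Import all_boot all_order all_algebra.
From mathcomp Require Import all_classical all_reals all_analysis.

Set Implicit Arguments.
Unset Strict Implicit.
Unset Printing Implicit Defensive.

Import Order.TTheory GRing.Theory Num.Theory.
Local Open Scope ring_scope.

(** [m = 1 + lambda / 2]: the halving is exact for even [lambda]. *)
Definition mq_m (lambda : nat) : nat := (1 + lambda./2)%N.

(** The difference [n - lambda] may be negative, so it is never taken in
    [nat]. *)
Definition mq_s (R : realType) (n lambda : nat) : int :=
  Num.ceil ((n%:R - lambda%:R - 3) / 2 : R).

Definition mq_rho (R : realType) (n lambda : nat) : R :=
  if 3 < n%:Z - lambda%:Z
  then 1 + (mq_s R n lambda)%:~R / (2 * (mq_m lambda)%:R + 3)
  else 1.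

Definition mq_c0 (R : realType) (n lambda : nat) (delta : R) : R :=
  24 * mq_rho R n lambda * ((mq_m lambda)%:R + 1) * delta.

Definition mq_c1 (R : realType) (n lambda : nat) (b0 : R) : R :=
  12 * mq_rho R n lambda * b0.

Definition mq_k (R : realType) (n lambda : nat) (sigma delta : R) : R :=
  sigma / 2 + ln (2 / 3) / (24 * mq_rho R n lambda * delta).

(** Only the values at [c >= c0] are meaningful.
    The two formulas agree at [c = c1]. *)
Definition MN (R : realType) (n lambda : nat) (sigma b0 delta c : R) : R :=
  if c <= mq_c1 n lambda b0
  then Num.sqrt (8 * mq_rho R n lambda)
       * c `^ ((lambda%:R - n%:R - 1) / 4)
       * expR (c * mq_k n lambda sigma delta)
  else Num.sqrt (2 / (3 * b0))
       * c `^ ((1 + lambda%:R - n%:R) / 4)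
       * expR (c * sigma / 2)
       * (2 / 3) `^ (b0 / (2 * delta)).

Definition MN_optimal (R : realType) (n lambda : nat) (sigma b0 delta c : R)
    : Prop :=
  mq_c0 n lambda delta <= c /\
  forall c' : R, mq_c0 n lambda delta <= c' ->
    MN n lambda sigma b0 delta c <= MN n lambda sigma b0 delta c'.

(* Main.v *)
Require Import Defs.
From HB Require Import structures.
From mathcomp Require Import all_boot all_order all_algebra.
From mathcomp Require Import all_classical all_reals all_analysis.
From mathcomp Require Import ring lra zify.

Set Implicit Arguments.
Unset Strict Implicit.
Unset Printing Implicit Defensive.

Import Order.TTheory GRing.Theory Num.Theory.
Local Open Scope ring_scope.

(** Since [lambda - n - 1 >= 0], we have [rho = 1] and the bound on [delta] says
    exactly [c0 < c1].  Each of the two formulas for [MN] is a constant times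
    [c ^ a * exp (b * c)] with [a, b >= 0], hence nondecreasing; as they agree
    at [c1], so is [MN] on [[c0, +oo[]. *)

Lemma ler_powR_expR (R : realType) (a b x y : R) :
  0 <= a -> 0 <= b -> 0 <= x -> x <= y ->
  x `^ a * expR (x * b) <= y `^ a * expR (y * b).
Proof.
move=> a0 b0 x0 xy; apply: ler_pM; rewrite ?powR_ge0 ?expR_ge0 //.
  by apply: ge0_ler_powR; rewrite // nnegrE (le_trans x0 xy).
by rewrite ler_expR ler_wpM2r.
Qed.

(** The two exponents of [c1] differ by one half, and the extra square root of [c1] merges with the
    prefactor of the second formula to give the first one. The power of [2 / 3] accounts for the
    logarithmic term of [mq_k]. *)
Lemma MN_agree_at_c1 (R : realType) (n lambda : nat) (sigma b0 delta : R) :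
  0 < mq_rho R n lambda -> 0 < b0 -> 0 < delta ->
  let c1 := mq_c1 n lambda b0 in
  Num.sqrt (8 * mq_rho R n lambda) * c1 `^ ((lambda%:R - n%:R - 1) / 4)
    * expR (c1 * mq_k n lambda sigma delta) =
  Num.sqrt (2 / (3 * b0)) * c1 `^ ((1 + lambda%:R - n%:R) / 4)
    * expR (c1 * sigma / 2) * (2 / 3) `^ (b0 / (2 * delta)).
Proof.
rewrite /mq_c1 /mq_k; move: (mq_rho R n lambda) => rho rho0 b00 delta0 /=.
have c10 : 0 < 12 * rho * b0 by rewrite !mulr_gt0.
have -> : (1 + lambda%:R - n%:R) / 4 = 2^-1 + (lambda%:R - n%:R - 1) / 4 :> R.
  by field.
rewrite powRD; last by rewrite (gt_eqF c10) implybT.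
rewrite powR12_sqrt ?(ltW c10) // [in RHS]mulrA -sqrtrM; last first.
  by rewrite ltW // divr_gt0 // mulr_gt0.
have -> : 2 / (3 * b0) * (12 * rho * b0) = 8 * rho by field; rewrite gt_eqF.
rewrite -[RHS]mulrA; congr (_ * _).
(* Written as an exponential, the power of [2 / 3] has exponent [b0 / (2 * delta) * ln (2 / 3)], and
   [b0 / (2 * delta)] is [c1 / (24 * rho * delta)]. *)
rewrite [in RHS]/powR gt_eqF ?divr_gt0 // -expRD; congr expR.
by field; rewrite !gt_eqF.
Qed.

Theorem mainTheorem3 (R : realType) (n lambda : nat) (sigma b0 delta : R)
    (hn2 : (2 <= n)%N) (hn : ~~ odd n)
    (hl2 : (2 <= lambda)%N) (hl : ~~ odd lambda)
    (hsigma : 0 < sigma) (hb0 : 0 < b0)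
    (hdelta0 : 0 < delta)
    (hdelta : delta < b0 / (2 * ((mq_m lambda)%:R + 1)))
    (hexp : 0 <= lambda%:Z - n%:Z - 1)
    (hk : 0 <= mq_k n lambda sigma delta) :
  MN_optimal n lambda sigma b0 delta (mq_c0 n lambda delta).
Proof.
have hlt : (n < lambda)%N by lia.
have rho1 : mq_rho R n lambda = 1 by rewrite /mq_rho ifF //; lia.
have hnl : n%:R + 1 <= lambda%:R :> R by rewrite natr1 ler_nat.
have m0 : 0 <= (mq_m lambda)%:R :> R by [].
have c00 : 0 <= mq_c0 n lambda delta by rewrite /mq_c0 rho1; nra.
have c01 : mq_c0 n lambda delta <= mq_c1 n lambda b0.
  rewrite /mq_c0 /mq_c1 rho1; move: hdelta.
  by rewrite ltr_pdivlMr; [nra | lra].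
(* Stated for the first formula rather than for [MN], so that it serves both on the first branch and
   at [c1], the bridge to the second. *)
have first_le c : mq_c0 n lambda delta <= c ->
    Num.sqrt (8 * mq_rho R n lambda)
      * mq_c0 n lambda delta `^ ((lambda%:R - n%:R - 1) / 4)
      * expR (mq_c0 n lambda delta * mq_k n lambda sigma delta) <=
    Num.sqrt (8 * mq_rho R n lambda) * c `^ ((lambda%:R - n%:R - 1) / 4)
      * expR (c * mq_k n lambda sigma delta).
  move=> c0c; rewrite -[leLHS]mulrA -[leRHS]mulrA.
  by rewrite ler_wpM2l ?sqrtr_ge0 // ler_powR_expR //; lra.
split=> // c c0c; rewrite /MN c01.
case: (leP c) => [_|/ltW c1c]; first exact: first_le.
(* Beyond [c1], go from [c0] to [c1] by the first formula, switch formulas there, and continue from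
   [c1] to [c] by the second. *)
apply: le_trans (first_le _ c01) _.
rewrite MN_agree_at_c1 ?rho1 // ler_wpM2r ?powR_ge0 //.
move: (mq_c1 n lambda b0) (le_trans c00 c01) c1c => c1 c10 c1c.
(* Reassociation also regroups the exponent as [c * (sigma / 2)], exposing the rate [sigma / 2]. *)
by rewrite -!mulrA ler_wpM2l ?sqrtr_ge0 // ler_powR_expR //; lra.
Qed.
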